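(* Let $R=R_1\times\cdots\times R_s$ be a finite commutative ring with identity $1\neq0$, where each $R_i$ is a finite local ring with maximal ideal $M_i$ of order $m_i$, $|R_1|/m_1\le\cdots\le|R_s|/m_s$, and $|R_i|/m_i\equiv 1\pmod 4$ for $1\le i\le s$. For disjoint subsets $A,B\subseteq\{1,\dots,s\}$ put $$\lambda_{A,B}=(-1)^{|B|}\frac{|R^\times|}{2^s\prod_{i\in A}\left(\sqrt{|R_i|/m_i}+1\right)\prod_{j\in B}\left(\sqrt{|R_j|/m_j}-1\right)}.$$ Then the eigenvalues of $\mathcal{G}_R$ (with multiplicity) are: (a) for every pair $(A,B)$ of disjoint subsets of $\{1,\dots,s\}$, the value $\lambda_{A,B}$, repeated $\frac{1}{2^{|A|+|B|}}\prod_{k\in A\cup B}(|R_k|/m_k-1)$ times; and (b) $0$ with multiplicity $|R|-\sum_{A,B\subseteq\{1,\dots,s\},\,A\cap B=\emptyset}\frac{1}{2^{|A|+|B|}}\prod_{k\in A\cup B}(|R_k|/m_k-1)$.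
   Context: A local ring is a commutative ring with a unique maximal ideal. For a finite commutative ring $R$, $R^\times$ is its unit group, $Q_R=\{u^2:u\in R^\times\}$, $T_R=Q_R\cup(-Q_R)$, and the quadratic unitary Cayley graph $\mathcal{G}_R$ has vertex set $R$ with $x,y$ adjacent iff $x-y\in T_R$. Eigenvalues of a graph are those of its adjacency matrix. Empty products equal $1$. *)

(* Defs.v *)
From HB Require Import structures.
From mathcomp Require Import all_boot all_order all_algebra.

Set Implicit Arguments.
Unset Strict Implicit.
Unset Printing Implicit Defensive.

Import GRing.Theory.
Local Open Scope ring_scope.

(* The direct product of a finite family of finite commutative rings, with    *)
(* componentwise operations. It is only a pzRing, since it is the zero ring   *)
(* when the index type is empty.                                              *)
Definition prod_ring (I : finType) (R : I -> finComNzRingType) : predArgType :=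
  {dffun forall i : I, R i}.

Section ProdRing.
Variables (I : finType) (R : I -> finComNzRingType).
Implicit Types x y z : prod_ring R.

HB.instance Definition _ := Finite.on (prod_ring R).

Definition prod_zero : prod_ring R := [ffun i : I => 0 : R i].
Definition prod_one : prod_ring R := [ffun i : I => 1 : R i].
Definition prod_opp x : prod_ring R := [ffun i : I => - x i : R i].
Definition prod_add x y : prod_ring R := [ffun i : I => x i + y i : R i].
Definition prod_mul x y : prod_ring R := [ffun i : I => x i * y i : R i].

Fact prod_addA : associative prod_add.
Proof. by move=> x y z; apply/ffunP => i; rewrite !ffunE addrA. Qed.
Fact prod_addC : commutative prod_add.
Proof. by move=> x y; apply/ffunP => i; rewrite !ffunE addrC. Qed.
Fact prod_add0 : left_id prod_zero prod_add.
Proof. by move=> x; apply/ffunP => i; rewrite !ffunE add0r. Qed.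
Fact prod_addN : left_inverse prod_zero prod_opp prod_add.
Proof. by move=> x; apply/ffunP => i; rewrite !ffunE addNr. Qed.

HB.instance Definition _ :=
  GRing.isZmodule.Build (prod_ring R) prod_addA prod_addC prod_add0 prod_addN.

Fact prod_mulA : associative prod_mul.
Proof. by move=> x y z; apply/ffunP => i; rewrite !ffunE mulrA. Qed.
Fact prod_mulC : commutative prod_mul.
Proof. by move=> x y; apply/ffunP => i; rewrite !ffunE mulrC. Qed.
Fact prod_mul1 : left_id prod_one prod_mul.
Proof. by move=> x; apply/ffunP => i; rewrite !ffunE mul1r. Qed.
Fact prod_mulDl : left_distributive prod_mul prod_add.
Proof. by move=> x y z; apply/ffunP => i; rewrite !ffunE mulrDl. Qed.

HB.instance Definition _ := GRing.Zmodule_isComPzRing.Build (prod_ring R)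
  prod_mulA prod_mulC prod_mul1 prod_mulDl.

End ProdRing.

Section LocalRing.
Variable R : finComNzRingType.

(* [idealr_closed] includes properness: it requires 1 \notin M. *)
Definition maximal_ideal (M : {set R}) : Prop :=
  idealr_closed (mem M) /\
  forall N : {set R}, idealr_closed (mem N) -> M \subset N -> N = M.

Definition local_with_maximal_ideal (M : {set R}) : Prop :=
  maximal_ideal M /\ forall N : {set R}, maximal_ideal N -> N = M.

End LocalRing.

Section QuadraticUnitaryCayleyGraph.
Variable R : finComPzRingType.

(* [GRing.unit] is not available here as R may be the zero ring. *)
Definition units : {set R} := [set u | [exists v : R, v * u == 1]].

Definition unit_squares : {set R} := [set u ^+ 2 | u in units].

Definition pm_unit_squares : {set R} :=
  unit_squares :|: [set - u | u in unit_squares].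

Definition quad_unitary_adj : rel R := fun x y => x - y \in pm_unit_squares.

End QuadraticUnitaryCayleyGraph.

Definition adjacency_mx (F : nzRingType) (T : finType) (e : rel T) :
    'M[F]_#|T| :=
  \matrix_(i, j) (e (enum_val i) (enum_val j))%:R.

(* The list l enumerates, with multiplicity and in any order, the eigenvalues *)
(* of A; in particular the characteristic polynomial of A splits over F.      *)
Definition eigenvalues_are (F : fieldType) (n : nat) (A : 'M[F]_n)
    (l : seq F) : Prop :=
  char_poly A = \prod_(x <- l) ('X - x%:P).

Section Spectrum.
Variables (s : nat) (R : 'I_s -> finComNzRingType).
Variable M : forall i, {set R i}.
Implicit Types A B : {set 'I_s}.

(* When M i is an ideal of R i this division is exact. *)
Definition residue_card (i : 'I_s) : nat := (#|R i| %/ #|M i|)%N.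

Definition lambda (F : rcfType) A B : F :=
  (-1) ^+ #|B| *
  (#|units (prod_ring R)|%:R /
   (2 ^+ s * \prod_(i in A) (Num.sqrt (residue_card i)%:R + 1)
           * \prod_(j in B) (Num.sqrt (residue_card j)%:R - 1))).

(* When A and B are disjoint and all the residue cardinals are odd this       *)
(* division is exact.                                                         *)
Definition lambda_mult A B : nat :=
  ((\prod_(k in A :|: B) (residue_card k - 1)) %/ 2 ^ (#|A| + #|B|))%N.

(* The subtraction does not truncate: for odd residue cardinals, the sum of   *)
(* the multiplicities is the product of the residue cardinals.                *)
Definition zero_mult : nat :=
  (#|prod_ring R| -
   \sum_(A : {set 'I_s}) \sum_(B : {set 'I_s} | [disjoint A & B])
     lambda_mult A B)%N.

End Spectrum.

(* Main.v *)
Require Import Defs.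
From mathcomp Require Import all_boot all_order all_algebra.
From mathcomp Require Import fingroup.
From mathcomp Require Import ring lra zify.

(* As -1 is a square in every factor, T_R is the set of unit squares, so its
   indicator is a product of indicators over the factors. On a local factor
   with residue field of order q and maximal ideal M of order m, the quadratic
   character chi is invariant under M and, for convolution,
     chi * chi = m (q [x in M] - 1).
   With j = 1/|R| and h = [x in M]/m this makes j and
   (h - j +- chi / (m sqrt q)) / 2 orthogonal idempotents of which the indicator
   of the squares is a combination. Products of these kernels over the factors
   give orthogonal idempotent matrices E_f with the adjacency matrix equal to
   a combination of the E_f, and the multiplicity of an eigenvalue is the trace
   of its idempotent. *)

Set Implicit Arguments.
Unset Strict Implicit.
Unset Printing Implicit Defensive.

Import Order.TTheory GRing.Theory Num.Theory.
Local Open Scope ring_scope.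

(** * Characteristic polynomials of sums of orthogonal idempotents *)

Lemma char_poly_mul_orthogonal (F : fieldType) (n : nat) (A B : 'M[F]_n) :
  A *m B = 0 -> char_poly A * char_poly B = 'X^n * char_poly (A + B).
Proof.
move=> AB0; rewrite /char_poly /char_poly_mx -det_mulmx -[in RHS]det_scalar -det_mulmx.
congr (\det _); rewrite map_mxD /= mulmxBl !mulmxBr -map_mxM AB0 map_mx0 subr0 mulmxDr.
by rewrite !mul_scalar_mx mul_mx_scalar opprD addrA addrAC.
Qed.

Lemma char_poly_scalar (F : fieldType) (n : nat) (l : F) :
  char_poly (l%:M : 'M_n) = ('X - l%:P) ^+ n.
Proof. by rewrite /char_poly /char_poly_mx map_scalar_mx /= -raddfB det_scalar. Qed.

Lemma char_poly_scale_idempotent (F : numFieldType) (n d : nat) (E : 'M[F]_n) (l : F) :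
    (0 < n)%N -> E *m E = E -> \tr E = d%:R ->
  (d <= n)%N /\ char_poly (l *: E) = 'X^(n - d) * ('X - l%:P) ^+ d.
Proof.
move=> n_gt0 EE trE.
suff {l} nz l : l != 0 ->
    (d <= n)%N /\ char_poly (l *: E) = 'X^(n - d) * ('X - l%:P) ^+ d.
  have dn := (nz 1 (oner_neq0 _)).1.
  split=> //; have [->|/nz[]//] := eqVneq l 0.
  rewrite scale0r subr0 -exprD subnK // /char_poly /char_poly_mx map_mx0 subr0.
  by rewrite det_scalar.
move=> l_neq0; set p := char_poly _.
have p_dvd : p %| \prod_(x <- nseq n (0 : F) ++ nseq n l) ('X - x%:P).
  apply/dvdpP; exists (char_poly (l *: (1%:M - E))).
  rewrite mulrC char_poly_mul_orthogonal; last first.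
    by rewrite -scalemxAl -scalemxAr mulmxBr mulmx1 EE subrr !scaler0.
  rewrite -scalerDr addrCA subrr addr0 scalemx1 char_poly_scalar.
  by rewrite big_cat !big_nseq !iter_mulr_1 subr0.
have [m] := dvdp_prod_XsubC p_dvd.
rewrite eqp_monic ?char_poly_monic ?monic_prod_XsubC // => /eqP p_eq.
set t := mask m _ in p_eq.
have t_in x : x \in t -> x = 0 \/ x = l.
  move=> /mem_mask; rewrite mem_cat !mem_nseq.
  by case/orP=> /andP[_ /eqP]; [left|right].
have size_t : size t = n.
  by apply: succn_inj; rewrite -(size_prod_XsubC t id) -p_eq size_char_poly.
have prod_t : \prod_(x <- t) ('X - x%:P) =
     'X^(n - count_mem l t) * ('X - l%:P) ^+ count_mem l t.
  rewrite -size_t -(count_predC (pred1 l) t) addKn.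
  elim: t t_in {p_eq size_t} => [|x t IH] t_in.
    by rewrite big_nil !expr0 mulr1.
  rewrite big_cons IH; last by move=> y yt; apply: t_in; rewrite inE yt orbT.
  case: (t_in x) => [|->|->]; first by rewrite inE eqxx.
    rewrite /= eq_sym (negbTE l_neq0) subr0 /= add0n exprS; ring.
  by rewrite /= eqxx /= add0n exprS; ring.
have sum_t : \sum_(x <- t) x = l * (count_mem l t)%:R.
  elim: t t_in {p_eq size_t prod_t} => [|x t IH] t_in.
    by rewrite big_nil mulr0.
  rewrite big_cons IH; last by move=> y yt; apply: t_in; rewrite inE yt orbT.
  case: (t_in x) => [|->|->]; first by rewrite inE eqxx.
    by rewrite /= eq_sym (negbTE l_neq0) !add0r.
  by rewrite /= eqxx natrD mulrDr mulr1.
have := coefPn_prod_XsubC (ps := t); rewrite -p_eq size_t char_poly_trace //.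
rewrite -lt0n => /(_ n_gt0)/oppr_inj.
rewrite mxtraceZ trE sum_t => /(mulfI l_neq0)/eqP; rewrite eqr_nat => /eqP d_eq.
by rewrite p_eq prod_t -d_eq; split=> //; rewrite d_eq -size_t count_size.
Qed.

Lemma char_poly_sum_idempotents (F : numFieldType) (n : nat) (K : finType)
    (E : K -> 'M[F]_n) (d : K -> nat) (l : K -> F) :
    (0 < n)%N -> (forall j k, E j *m E k = if j == k then E j else 0) ->
    (forall j, \tr (E j) = (d j)%:R) ->
  (\sum_j d j <= n)%N /\
  char_poly (\sum_j l j *: E j) =
    'X^(n - \sum_j d j) * \prod_j ('X - (l j)%:P) ^+ d j.
Proof.
move=> n_gt0 EE trE.
have sum_E (r : seq K) k : k \notin r -> (\sum_(j <- r) l j *: E j) *m E k = 0.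
  move=> kr; rewrite mulmx_suml big_seq big1 // => j jr.
  by rewrite -scalemxAl EE (negbTE (memPn kr j jr)) scaler0.
have dn : (\sum_j d j <= n)%N.
  apply: (proj1 (@char_poly_scale_idempotent F n _ (\sum_j E j) 1 n_gt0 _ _)).
    rewrite mulmx_suml; apply: eq_bigr => j _.
    rewrite mulmx_sumr (bigD1 j) //= EE eqxx big1 ?addr0 // => k.
    by rewrite EE eq_sym => /negbTE->.
  by rewrite raddf_sum natr_sum; apply: eq_bigr => j _; exact: trE.
split=> //.
(* Multiplying by 'X^_ avoids truncated subtraction during the induction. *)
suff IH (r : seq K) : uniq r ->
   char_poly (\sum_(j <- r) l j *: E j) * 'X^(\sum_(j <- r) d j) =
    'X^n * \prod_(j <- r) ('X - (l j)%:P) ^+ d j.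
  apply: (mulIf (expf_neq0 (\sum_j d j) (negbT (polyX_eq0 F)))).
  rewrite IH ?index_enum_uniq // mulrAC -exprD subnK //.
elim: r => [_|k r IH /= /andP[kr /IH{}IH]].
  rewrite !big_nil /char_poly /char_poly_mx map_mx0 subr0 det_scalar expr0.
  by rewrite mulr1.
rewrite !big_cons.
apply: (mulfI (expf_neq0 n (negbT (polyX_eq0 F)))).
rewrite [LHS]mulrA [l k *: _ + _]addrC -char_poly_mul_orthogonal; last first.
  by rewrite -scalemxAr sum_E // scaler0.
have EEk := EE k k; rewrite eqxx in EEk.
have [dk ->] := @char_poly_scale_idempotent F n _ _ (l k) n_gt0 EEk (trE k).
rewrite exprD.
have Xn : 'X^n = 'X^(n - d k) * 'X^(d k) :> {poly F} by rewrite -exprD subnK.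
transitivity ((char_poly (\sum_(j <- r) l j *: E j) * 'X^(\sum_(j <- r) d j))
   * ('X^(n - d k) * 'X^(d k)) * ('X - (l k)%:P) ^+ d k); first by ring.
by rewrite IH -Xn; ring.
Qed.

Lemma sum_prod_dffun (F : comPzRingType) (I : finType) (T : I -> finType)
    (f : forall i, T i -> F) :
  \sum_(x : {dffun forall i, T i}) \prod_i f i (x i) = \prod_i \sum_(y : T i) f i y.
Proof.
pose P i : {ffun T i -> F} := [ffun y => f i y].
rewrite (reindex (@dffun_of_fprod I T)) /=; last exact/onW_bij/dffun_of_fprod_bij.
transitivity (\sum_(t : fprod T) \prod_(i in I) P i (t i)).
  by apply: eq_bigr => t _; apply: eq_bigr => i _; rewrite !ffunE.
rewrite big_fprod -(bigA_distr_big_dep _ (fun i u => untag 0 (P i) u)).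
by apply: eq_bigr => i _; rewrite -(big_tag P i); apply: eq_bigr => y _; rewrite ffunE.
Qed.

(** * The quadratic character of a finite local ring *)

Lemma card_two_to_one (T T' : finType) (A : {set T}) (g : T -> T') :
    (forall x, x \in A -> #|[set y in A | g y == g x]| = 2%N) ->
  #|A| = (#|g @: A| * 2)%N.
Proof.
move=> fiber2; rewrite -sum1_card (partition_big_imset g) /= -sum_nat_const.
by apply: eq_bigr => _ /imsetP[x /fiber2 <- ->]; rewrite -sum1dep_card.
Qed.

Lemma unitsP (R : finComPzRingType) (u : R) :
  reflect (exists v, v * u = 1) (u \in units R).
Proof. by rewrite inE; apply: (iffP existsP) => -[v /eqP]; exists v => //; apply/eqP. Qed.

Definition conv (F : pzSemiRingType) (G : finZmodType) (f g : G -> F) (c : G) : F :=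
  \sum_z f z * g (c - z).

Lemma sum_shift (F : nmodType) (G : finZmodType) (f : G -> F) (c : G) :
  \sum_z f (c - z) = \sum_z f z.
Proof.
rewrite [RHS](reindex_inj (h := fun z => c - z)) // => x y /addrI.
exact: oppr_inj.
Qed.

Lemma convC (F : comPzRingType) (G : finZmodType) (f g : G -> F) (c : G) :
  conv f g c = conv g f c.
Proof.
rewrite /conv -(sum_shift (fun z => g z * f (c - z)) c).
by apply: eq_bigr => z _; rewrite mulrC subKr.
Qed.

Section LocalRing.
Variables (R : finComNzRingType) (M : {set R}).
Hypothesis localM : local_with_maximal_ideal M.

Local Notation U := (units R).
Local Notation S := (unit_squares R).

Let M_ideal : idealr_closed (mem M). Proof. by case: localM => -[]. Qed.
Let M0 : 0 \in M. Proof. by case: M_ideal. Qed.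
Let M1 : 1 \notin M. Proof. by case: M_ideal. Qed.
Let MM a x : x \in M -> a * x \in M.
Proof. by case: M_ideal => m0 _ MD xM; rewrite -[_ * _]addr0; apply: (MD). Qed.
Let MD x y : x \in M -> y \in M -> x + y \in M.
Proof. by case: M_ideal => _ _ MD xM yM; rewrite -[x]mul1r; apply: (MD). Qed.
Let MN x : (- x \in M) = (x \in M).
Proof.
have N y : y \in M -> - y \in M by move=> yM; rewrite -mulN1r MM.
by apply/idP/idP => /N //; rewrite opprK.
Qed.
Lemma ideal_add_mem x y : y \in M -> (x + y \in M) = (x \in M).
Proof.
move=> yM; apply/idP/idP => [xyM|xM]; last exact: MD.
by rewrite -(addrK y x) MD ?MN.
Qed.

Lemma units_local : U = ~: M.
Proof.
apply/setP => x; rewrite in_setC; apply/unitsP/idP => [[v vx]|xM].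
  by apply: contra M1 => xM; rewrite -vx MM.
pose ideal (N : {set R}) := [&& 0 \in N, 1 \notin N &
  [forall a, forall u, forall v, (u \in N) ==> (v \in N) ==> (a * u + v \in N)]].
have idealP (N : {set R}) : reflect (idealr_closed (mem N)) (ideal N).
  apply: (iffP and3P) => -[N0 N1 ND]; split=> //.
    move=> a u v uN vN; move/forallP/(_ a)/forallP/(_ u)/forallP/(_ v): ND.
    by move/implyP/(_ uN)/implyP/(_ vN).
  apply/forallP => a; apply/forallP => u; apply/forallP => v.
  by apply/implyP => uN; apply/implyP => vN; apply: (ND).
pose X := [set v * x | v : R].
have [/imsetP[v _ v1]|X1] := boolP (1 \in X); first by exists v.
have /maxset_exists[N /maxsetP[/idealP N_ideal N_max] XN] : ideal X.
  apply/idealP; split=> //.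
    by apply/imsetP; exists 0; rewrite ?mul0r.
  move=> a _ _ /imsetP[u _ ->] /imsetP[v _ ->]; apply/imsetP.
  by exists (a * u + v); rewrite // mulrDl mulrA.
have NM : N = M.
  apply: localM.2; split=> // N' /idealP N'_ideal NN'; exact: N_max.
case/negP: xM; rewrite -NM; apply: (subsetP XN); apply/imsetP; exists 1 => //.
by rewrite mul1r.
Qed.

Let unitNM x : (x \in U) = (x \notin M). Proof. by rewrite units_local inE. Qed.

Let U1 : 1 \in U. Proof. by rewrite unitNM. Qed.
Let UM x y : (x * y \in U) = (x \in U) && (y \in U).
Proof.
apply/idP/andP => [|[/unitsP[a ax] /unitsP[b yb]]].
  by move=> xyU; split; apply: contraLR xyU; rewrite !unitNM !negbK; last exact: MM;
     rewrite mulrC; apply: MM.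
by apply/unitsP; exists (a * b); rewrite mulrACA ax yb mulr1.
Qed.
Let UN x : (- x \in U) = (x \in U). Proof. by rewrite !unitNM MN. Qed.
Let mulUI x y z : x \in U -> x * y = x * z -> y = z.
Proof.
by move=> /unitsP[v vx] /(congr1 ( *%R v)); rewrite !mulrA vx !mul1r.
Qed.

Let inv (u : R) : R := odflt 0 [pick v | v * u == 1].
Let mulVu u : u \in U -> inv u * u = 1.
Proof.
move=> /unitsP[v vu]; rewrite /inv; case: pickP => [w /eqP //|/(_ v)].
by rewrite vu eqxx.
Qed.
Let UV u : u \in U -> inv u \in U.
Proof. by move=> uU; have := U1; rewrite -(mulVu uU) UM => /andP[]. Qed.
Let invK u : u \in U -> inv (inv u) = u.
Proof.
move=> uU; apply: (mulUI (UV uU)); rewrite [LHS]mulrC mulVu ?UV //.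
by rewrite mulVu.
Qed.

Lemma card_local : #|R| = ((#|R| %/ #|M|) * #|M|)%N.
Proof.
have gM : group_set M.
  by apply/group_setP; split=> // x y; apply: MD.
rewrite divnK // -cardsT.
exact: (@cardSg _ [group of [set: R]] (Group gM) (subsetT _)).
Qed.

Let m_gt0 : (0 < #|M|)%N. Proof. by apply/card_gt0P; exists 0. Qed.

Lemma card_units_local : #|U| = (#|M| * (#|R| %/ #|M| - 1))%N.
Proof.
rewrite units_local cardsCs setCK mulnBr muln1 {1}card_local mulnC //.
Qed.

Hypothesis q_mod4 : (#|R| %/ #|M| = 1 %[mod 4])%N.

Let two_unit : (2%:R : R) \in U.
Proof.
rewrite unitNM; apply/negP => M2.
pose M' := M :|: [set 1 + x | x in M].
have M'P x : (x \in M') = (x \in M) || (x - 1 \in M).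
  rewrite inE; congr (_ || _); apply/imsetP/idP => [[y yM ->]|xM].
    by rewrite addrAC subrr add0r.
  by exists (x - 1) => //; rewrite addrCA subrr addr0.
have gM' : group_set M'.
  apply/group_setP; split=> [|x y]; rewrite !M'P; first by rewrite [_ \in M]M0.
  rewrite -[(x * y)%g]/(x + y) => /orP[] x_in /orP[] y_in.
  - by rewrite (MD x_in y_in).
  - by rewrite -[x + y - 1]addrA (MD x_in y_in) orbT.
  - by rewrite [x + y - 1]addrAC (MD x_in y_in) orbT.
  - have -> : x + y = 2%:R + ((x - 1) + (y - 1)) by ring.
    by rewrite (MD M2 (MD x_in y_in)).
have cM' : #|M'| = (2 * #|M|)%N.
  rewrite cardsU card_imset; last exact: addrI.
  suff -> : M :&: [set 1 + x | x in M] = set0 by rewrite cards0 subn0 mul2n addnn.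
  apply/setP => x; rewrite !inE; apply/negP => /andP[xM /imsetP[y yM x_eq]].
  by case/negP: M1; rewrite x_eq ideal_add_mem in xM.
have : (#|M'| %| #|R|)%N.
  rewrite -[#|R|]cardsT.
  exact: (@cardSg _ [group of [set: R]] (Group gM') (subsetT _)).
rewrite cM' card_local dvdn_pmul2r //.
by move: q_mod4; lia.
Qed.

Let sqr_eq_unit u v : u \in U -> (u ^+ 2 == v ^+ 2) = (u == v) || (u == - v).
Proof.
move=> uU; apply/eqP/orP => [uv|[/eqP->|/eqP->]//]; last by rewrite sqrrN.
have /eqP : (u - v) * (u + v) = 0 by rewrite -subr_sqr uv subrr.
have [uvU|] := boolP (u + v \in U).
  move=> /eqP; rewrite mulrC -(mulr0 (u + v)) => /(mulUI uvU)/eqP.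
  by rewrite subr_eq0; left.
rewrite unitNM negbK => uvM.
have uvU : u - v \in U.
  rewrite -[u - v](_ : 2%:R * u + - (u + v) = _); last by ring.
  by rewrite unitNM ideal_add_mem ?MN // -unitNM UM two_unit.
by move=> /eqP; rewrite -(mulr0 (u - v)) => /(mulUI uvU)/eqP; rewrite addr_eq0; right.
Qed.

Let neqN u : u \in U -> u != - u.
Proof.
move=> uU; rewrite -addr_eq0 -mulr2n -mulr_natl; apply: contraTneq M0 => <-.
by rewrite -unitNM UM two_unit.
Qed.

Lemma card_unit_squares : #|U| = (#|S| * 2)%N.
Proof.
apply: card_two_to_one => u uU.
suff -> : [set v in U | v ^+ 2 == u ^+ 2] = [set u; - u] by rewrite cards2 neqN.
apply/setP => v; rewrite in_set in_set2.
have [vU|vU] := boolP (v \in U); first by rewrite sqr_eq_unit.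
by apply/esym/norP; split; apply: contraNneq vU => ->; rewrite ?UN.
Qed.

Let SU x : x \in S -> x \in U.
Proof. by move=> /imsetP[u uU ->]; rewrite UM uU. Qed.

Lemma ideal_nonsquare x : x \in M -> x \notin S.
Proof. by move=> xM; apply: contraL xM => /SU; rewrite unitNM. Qed.

Let SM x y : x \in S -> y \in S -> x * y \in S.
Proof.
move=> /imsetP[u uU ->] /imsetP[v vU ->].
by apply/imsetP; exists (u * v); rewrite ?UM ?uU ?exprMn.
Qed.

Let S1 : 1 \in S. Proof. by apply/imsetP; exists 1; rewrite ?expr1n. Qed.

Let SV x : x \in S -> inv x \in S.
Proof.
move=> xS; have xU := SU xS; case/imsetP: xS => u uU x_eq.
apply/imsetP; exists (inv u); rewrite ?UV //; apply: (mulUI xU).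
by rewrite mulrC mulVu // x_eq -exprMn mulrC mulVu // expr1n.
Qed.

(* Squaring is injective on 1 + M because 2 is a unit, so it permutes it. *)
Let S1M x : x \in M -> 1 + x \in S.
Proof.
pose A := [set 1 + y | y in M].
have AU y : y \in A -> y \in U.
  by move=> /imsetP[z zM ->]; rewrite unitNM ideal_add_mem.
have sqA : [set y ^+ 2 | y in A] = A.
  have inj : {in A &, injective (fun y : R => y ^+ 2)}.
    move=> _ _ /imsetP[y yM ->] /imsetP[z zM ->] /eqP.
    rewrite sqr_eq_unit ?AU ?imset_f // => /orP[/eqP//|].
    rewrite -subr_eq0 opprK => /eqP yz; have := two_unit; rewrite unitNM.
    have -> : 2%:R = - (y + z) by rewrite -[LHS]subr0 -yz; ring.
    by rewrite MN MD.
  apply/eqP; rewrite eqEcard (card_in_imset inj) leqnn andbT.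
  apply/subsetP => _ /imsetP[_ /imsetP[z zM ->] ->]; apply/imsetP.
  by exists (z * (2%:R + z)); [rewrite mulrC MM | ring].
move=> xM; have : 1 + x \in A by rewrite imset_f.
by rewrite -sqA => /imsetP[y /AU yU ->]; apply/imsetP; exists y.
Qed.

Let SDM x y : y \in M -> (x + y \in S) = (x \in S).
Proof.
have D z t : t \in M -> z \in S -> z + t \in S.
  move=> tM zS; have zU := SU zS.
  have -> : z + t = z * (1 + inv z * t) by rewrite mulrDr mulr1 mulrA [z * _]mulrC mulVu // mul1r.
  by rewrite SM ?S1M ?MM.
move=> yM; apply/idP/idP; last exact: D.
by move=> /(D _ (- y)); rewrite addrK MN; apply.
Qed.

(* Otherwise inversion on the group of squares would fix only 1, and the number
   of squares, which is even since q = 1 mod 4, would be odd. *)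
Lemma opp1_unit_square : -1 \in S.
Proof.
apply/negPn/negP => N1S.
suff : #|S :\ 1| = (#|[set [set x; inv x] | x in S :\ 1%R]| * 2)%N.
  have := card_units_local; rewrite card_unit_squares (cardsD1 (1 : R)%R S) S1 add1n.
  move: q_mod4; set q := (#|R| %/ #|M|)%N => q_mod.
  have -> : (q - 1 = (q %/ 4) * 4)%N by lia.
  set c := (#|M| * _)%N => cM; have : (c %% 4 = 0)%N by rewrite /c mulnA modnMl.
  move=> c4 S2; rewrite S2 in cM; clearbody c; lia.
apply: card_two_to_one => x; rewrite in_setD1 => /andP[x1 xS].
have xU := SU xS.
have inv1 y : y \in U -> inv y = 1 -> y = 1.
  by move=> yU y1; rewrite -[y]invK // y1 -[LHS]mulr1 mulVu.
have xx : x != inv x.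
  apply: contraNneq x1 => x_inv; have /eqP : x ^+ 2 = 1 ^+ 2.
    by rewrite expr2 {1}x_inv mulVu ?expr1n.
  rewrite sqr_eq_unit // => /orP[//|/eqP xN1].
  by case/negP: N1S; rewrite -xN1.
suff -> : [set y in S :\ 1 | [set y; inv y] == [set x; inv x]] = [set x; inv x].
  by rewrite cards2 xx.
apply/setP => y; rewrite in_set in_set2 in_setD1; apply/andP/orP.
  move=> [_ /eqP/setP/(_ y)]; rewrite !inE eqxx /= => /esym/orP//.
case=> /eqP->; first by rewrite x1 xS.
rewrite SV // invK // setUC eqxx andbT; split=> //.
by apply: contra x1 => /eqP/(inv1 _ xU)->.
Qed.

Let SN x : (- x \in S) = (x \in S).
Proof.
have N y : y \in S -> - y \in S by move=> yS; rewrite -mulN1r SM // opp1_unit_square.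
by apply/idP/idP => /N //; rewrite opprK.
Qed.

Let SMl x y : x \in S -> (x * y \in S) = (y \in S).
Proof.
move=> xS; apply/idP/idP; last exact: SM.
by move=> /(SM (SV xS)); rewrite mulrA mulVu ?SU // mul1r.
Qed.

(* Because the squares have index 2 in the units. *)
Let SMN x y : x \in U :\: S -> y \in U :\: S -> x * y \in S.
Proof.
rewrite !in_setD => /andP[xS xU] /andP[yS yU].
suff : x * y \notin [set x * z | z in S].
  suff -> : [set x * z | z in S] = U :\: S by rewrite in_setD UM xU yU !andbT negbK.
  apply/eqP; rewrite eqEcard card_imset; last by move=> a b /(mulUI xU).
  rewrite cardsD (setIidPr _); last by apply/subsetP => z /SU.
  rewrite card_unit_squares muln2 -addnn addnK leqnn andbT.
  apply/subsetP => _ /imsetP[z zS ->]; rewrite in_setD UM xU SU // !andbT.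
  by rewrite mulrC SMl.
by apply: contra yS => /imsetP[z zS /(mulUI xU) ->].
Qed.

Section Character.
Variable F : rcfType.

Definition quad_char (x : R) : F :=
  if x \in M then 0 else if x \in S then 1 else -1.
Local Notation chi := quad_char.

Let chiM x y : chi (x * y) = chi x * chi y.
Proof.
rewrite /chi; have [xM|xM] := boolP (x \in M); first by rewrite mulrC MM // mul0r.
have [yM|yM] := boolP (y \in M); first by rewrite MM // mulr0.
have := UM x y; rewrite !unitNM xM yM => /negbTE->.
have [xS|xS] := boolP (x \in S); first by rewrite SMl // mul1r.
have [yS|yS] := boolP (y \in S); first by rewrite mulrC SMl // (negbTE xS) mulr1.
by rewrite SMN ?in_setD ?xS ?yS ?unitNM // mulrNN mulr1.
Qed.

Lemma quad_char_add x y : y \in M -> chi (x + y) = chi x.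
Proof. by move=> yM; rewrite /chi ideal_add_mem // SDM. Qed.

Let chiN x : chi (- x) = chi x. Proof. by rewrite /chi MN SN. Qed.

Lemma sum_quad_char : \sum_x chi x = 0.
Proof.
rewrite (bigID (mem M)) /= big1 ?add0r => [|x xM]; last by rewrite /chi xM.
rewrite (bigID (mem S)) /=.
rewrite (eq_bigl (fun x => x \in S)) => [|x]; last first.
  by rewrite /= -unitNM; have [/SU->|] := boolP (x \in S); rewrite ?andbF.
rewrite (eq_bigr (fun=> 1)) => [|x xS]; last first.
  by rewrite /chi xS; have := SU xS; rewrite unitNM => /negbTE->.
rewrite sumr_const (eq_bigl (fun x => x \in U :\: S)) => [|x]; last first.
  by rewrite /= in_setD unitNM andbC.
rewrite (eq_bigr (fun=> -1)) => [|x]; last first.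
  by rewrite in_setD unitNM => /andP[/negbTE xS /negbTE xM]; rewrite /chi xM xS.
rewrite sumr_const cardsD (setIidPr _); last by apply/subsetP => z /SU.
by rewrite card_unit_squares muln2 -addnn addnK mulNrn subrr.
Qed.

Lemma conv_quad_char c :
  conv chi chi c = if c \in M then #|U|%:R else - #|M|%:R.
Proof.
rewrite /conv (bigID (mem M)) /= big1 ?add0r => [|x xM]; last by rewrite /chi xM mul0r.
rewrite (eq_bigl (fun x => x \in U)) => [|x]; last by rewrite /= unitNM.
have chi2 x : x \in U -> chi x * chi x = 1.
  by rewrite /chi unitNM => /negbTE->; case: ifP => _; rewrite ?mulrNN mulr1.
have [cM|cM] := boolP (c \in M).
  rewrite -sumr_const; apply: eq_bigr => x xU.
  by rewrite addrC quad_char_add // chiN chi2.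
have cU : c \in U by rewrite unitNM.
transitivity (\sum_(x in U) chi (c * inv x - 1)).
  apply: eq_bigr => x xU.
  have -> : c - x = x * (c * inv x - 1) by rewrite mulrBr mulr1 mulrCA [x * _]mulrC mulVu // mulr1.
  by rewrite chiM mulrA chi2 // mul1r.
have cU' x : x \in U -> c * inv x \in U by move=> xU; rewrite UM cU UV.
have cK x : x \in U -> c * inv (c * inv x) = x.
  move=> xU; apply: (mulUI (cU' x xU)).
  by rewrite mulrCA [_ * inv (_ * _)]mulrC mulVu ?cU' // mulr1 -mulrA mulVu // mulr1.
transitivity (\sum_(x in U) chi (x - 1)).
  rewrite [RHS](reindex_onto (fun x => c * inv x) (fun x => c * inv x)) //.
  apply: eq_bigl => x; apply/idP/andP => [xU|[xU /eqP<-]]; last exact: cU'.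
  by split; [exact: cU' | apply/eqP/cK].
apply: (addrI (\sum_(x in M) chi (x - 1))).
transitivity (\sum_x chi (x - 1)).
  rewrite [RHS](bigID (mem M)) /=; congr (_ + _).
  by apply: eq_bigl => x; rewrite unitNM.
rewrite (eq_bigr (fun x => chi (1 - x))) => [|x _]; last by rewrite -chiN opprB.
rewrite (sum_shift chi) sum_quad_char (eq_bigr (fun=> 1)) ?sumr_const ?subrr // => x xM.
by rewrite addrC quad_char_add // chiN /chi (negbTE M1) S1.
Qed.

End Character.
End LocalRing.

(** * Idempotents of one local ring *)

(* The eigenprojections of the Cayley graph of the squares of one local ring,
   as convolution kernels: None is the projection onto constant functions, and
   Some true, Some false those for the eigenvalues m (sqrt q - 1) / 2 and
   - m (sqrt q + 1) / 2; the functions with zero sum on every coset of M form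
   the kernel and need no projection. *)
Definition local_idem (F : rcfType) (R : finComNzRingType) (M : {set R})
    (a : option bool) (x : R) : F :=
  if a is Some b then
    ((x \in M)%:R / #|M|%:R - #|R|%:R^-1 +
     (if b then 1 else -1) * (quad_char M F x /
        (#|M|%:R * Num.sqrt (#|R| %/ #|M|)%:R))) / 2
  else #|R|%:R^-1.

Definition local_mult (q : nat) (a : option bool) : nat :=
  if a is Some _ then ((q - 1) %/ 2)%N else 1%N.

Definition local_eigenvalue (F : rcfType) (u q : nat) (a : option bool) : F :=
  u%:R / 2 * match a with
             | None => 1
             | Some true => (Num.sqrt q%:R + 1)^-1
             | Some false => - (Num.sqrt q%:R - 1)^-1
             end.

Section LocalIdempotents.
Variables (F : rcfType) (R : finComNzRingType) (M : {set R}).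
Hypothesis localM : local_with_maximal_ideal M.
Hypothesis q_mod4 : (#|R| %/ #|M| = 1 %[mod 4])%N.

Local Notation m := (#|M|%:R : F).
Local Notation n := (#|R|%:R : F).
Local Notation q := (#|R| %/ #|M|)%N.
Local Notation r := (Num.sqrt q%:R : F).
Local Notation chi := (quad_char M F).
Local Notation e := (local_idem F M).

Let j (x : R) : F := n^-1.
Let h (x : R) : F := (x \in M)%:R / m.
Let p (x : R) : F := chi x / (m * r).

Let M0 : 0 \in M. Proof. by case: localM => -[[]]. Qed.

Let m_neq0 : m != 0.
Proof. by rewrite pnatr_eq0 -lt0n; apply/card_gt0P; exists 0. Qed.

Lemma residue_card_gt1 : (1 < q)%N.
Proof.
have : (0 < #|units R|)%N by apply/card_gt0P; exists 1; apply/unitsP; exists 1; rewrite mul1r.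
by rewrite (card_units_local localM) muln_gt0 => /andP[_]; rewrite subn_gt0.
Qed.

Let r2 : r ^+ 2 = q%:R. Proof. by rewrite sqr_sqrtr // ler0n. Qed.
Let r_gt1 : 1 < r.
Proof. by rewrite -[X in X < _]sqrtr1 ltr_sqrt ?ltr0n ?ltr1n ?(ltnW residue_card_gt1) ?residue_card_gt1. Qed.
Let r_neq0 : r != 0. Proof. by apply/eqP; move: r_gt1; lra. Qed.
Let nE : n = r ^+ 2 * m.
Proof. by rewrite r2 -natrM -(card_local localM). Qed.

Let uE : #|units R|%:R = m * (r ^+ 2 - 1).
Proof. by rewrite (card_units_local localM) natrM natrB ?r2 // ltnW // residue_card_gt1. Qed.

Let n_neq0 : n != 0. Proof. by rewrite nE mulf_neq0 ?expf_neq0. Qed.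

Let conv_j (f : R -> F) c : conv j f c = (\sum_x f x) / n.
Proof. by rewrite /conv -mulr_sumr (sum_shift f) mulrC. Qed.

Let conv_h (f : R -> F) c : (forall x y, y \in M -> f (x + y) = f x) -> conv h f c = f c.
Proof.
move=> fM; rewrite /conv (bigID (mem M)) /= [X in _ + X]big1 ?addr0 => [|x /negbTE]; last first.
  by rewrite /h => ->; rewrite !mul0r.
rewrite (eq_bigr (fun=> f c / m)) => [|x xM].
  by rewrite sumr_const -[LHS]mulr_natr divfK.
have MN : - x \in M by case: localM => -[[_ _ MD] _] _; rewrite -mulN1r -[_ * _]addr0; apply: (MD).
by rewrite /h xM mul1r mulrC fM.
Qed.

Let sum_j : \sum_x j x = 1.
Proof. by rewrite sumr_const -[LHS]mulr_natr mulVf. Qed.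

Let sum_h : \sum_x h x = 1.
Proof. by rewrite -mulr_suml -natr_sum -big_mkcond sum1_card divff. Qed.

Let sum_p : \sum_x p x = 0.
Proof. by rewrite -mulr_suml sum_quad_char // mul0r. Qed.

Let hM x y : y \in M -> h (x + y) = h x.
Proof. by move=> yM; rewrite /h ideal_add_mem. Qed.

Let pM x y : y \in M -> p (x + y) = p x.
Proof. by move=> yM; rewrite /p quad_char_add. Qed.

Let pp c : conv p p c = h c - j c.
Proof.
transitivity (conv chi chi c / (m * r) ^+ 2).
  by rewrite /conv mulr_suml; apply: eq_bigr => x _; rewrite /p; field; rewrite m_neq0 r_neq0.
rewrite conv_quad_char // uE /h /j nE; case: ifP => _ /=; field; by rewrite m_neq0 r_neq0.
Qed.

Let coef (a : option bool) : F * F * F :=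
  match a with
  | None => (1, 0, 0)
  | Some b => (- 2^-1, 2^-1, (if b then 1 else -1) / 2)
  end.

Let eE a x : e a x = (coef a).1.1 * j x + (coef a).1.2 * h x + (coef a).2 * p x.
Proof.
case: a => [b|] /=; last by rewrite mul1r !mul0r !addr0.
by rewrite -/(h x) -/(j x) -/(p x); case: b; field.
Qed.

Lemma conv_local_idem a b c : conv (e a) (e b) c = if a == b then e a c else 0.
Proof.
have -> : conv (e a) (e b) c =
  (coef a).1.1 * (coef b).1.1 * conv j j c + (coef a).1.1 * (coef b).1.2 * conv j h c
  + (coef a).1.1 * (coef b).2 * conv j p c + (coef a).1.2 * (coef b).1.1 * conv h j c
  + (coef a).1.2 * (coef b).1.2 * conv h h c + (coef a).1.2 * (coef b).2 * conv h p c
  + (coef a).2 * (coef b).1.1 * conv p j c + (coef a).2 * (coef b).1.2 * conv p h c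
  + (coef a).2 * (coef b).2 * conv p p c.
  rewrite /conv !mulr_sumr -!big_split /=; apply: eq_bigr => x _.
  by rewrite !eE; ring.
rewrite (convC h j) (convC p j) (convC p h) !conv_j !conv_h // pp sum_j sum_h sum_p.
have jE : j c = 1 / n by rewrite /j div1r.
rewrite -jE mul0r eE.
by case: a b => [[]|] [[]|] /=; field.
Qed.

Lemma unit_squares_local_idem x :
  (x \in unit_squares R)%:R = \sum_a local_eigenvalue F #|units R| q a * e a x.
Proof.
have r1 : r + 1 != 0 by apply/eqP; move: r_gt1; lra.
have r1' : r - 1 != 0 by apply/eqP; move: r_gt1; lra.
rewrite /local_eigenvalue (bigD1 None) //= (bigD1 (Some true)) //= (bigD1 (Some false)) //=.
rewrite big1 ?addr0 => [|[[]|] //]; rewrite uE nE /quad_char.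
have [xM|xM] := boolP (x \in M).
  rewrite (negbTE (ideal_nonsquare _ xM)) //=.
  by field; rewrite m_neq0 r_neq0 r1 r1'.
by case: ifP => _ /=; field; rewrite m_neq0 r_neq0 r1 r1'.
Qed.

Lemma trace_local_idem a : n * e a 0 = (local_mult q a)%:R.
Proof.
case: a => [b|] /=; last by rewrite divff.
have q2 : (q = (q - 1) %/ 2 * 2 + 1)%N by move: q_mod4; move: (#|R| %/ #|M|)%N => k; lia.
have /(congr1 (fun k => k%:R : F)) := q2; rewrite natrD natrM -r2 => r_eq.
rewrite /quad_char M0 mul0r mulr0 addr0 nE.
apply: (mulIf (_ : 2%:R != 0 :> F)); first by rewrite pnatr_eq0.
have {r_eq}-> : ((q - 1) %/ 2)%:R * 2%:R = r ^+ 2 - 1 by rewrite r_eq addrK.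
by rewrite -[true%:R]/1; field; rewrite m_neq0 r_neq0.
Qed.

End LocalIdempotents.

(** * Products of local rings *)

Definition conv_mx (F : pzSemiRingType) (G : finZmodType) (f : G -> F) : 'M[F]_#|G| :=
  \matrix_(i, j) f (enum_val i - enum_val j).

Lemma conv_mx_mul (F : pzRingType) (G : finZmodType) (f g : G -> F) :
  conv_mx f *m conv_mx g = conv_mx (conv f g).
Proof.
apply/matrixP => i j; rewrite !mxE.
transitivity (\sum_(z : G) f (enum_val i - z) * g (z - enum_val j)).
  rewrite [RHS](reindex _ (onW_bij _ (@enum_val_bij G))) /=.
  by apply: eq_bigr => k _; rewrite !mxE.
rewrite -(sum_shift _ (enum_val i)); apply: eq_bigr => z _.
by rewrite subKr addrAC.
Qed.

Lemma conv_mx_trace (F : pzRingType) (G : finZmodType) (f : G -> F) :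
  \tr (conv_mx f) = #|G|%:R * f 0.
Proof.
rewrite /mxtrace (eq_bigr (fun=> f 0)) => [|i _]; last by rewrite mxE subrr.
by rewrite sumr_const card_ord mulr_natl.
Qed.

Lemma eq_conv_mx (F : pzRingType) (G : finZmodType) (f g : G -> F) :
  f =1 g -> conv_mx f = conv_mx g.
Proof. by move=> fg; apply/matrixP => i j; rewrite !mxE fg. Qed.

Section ProductRing.
Variables (I : finType) (R : I -> finComNzRingType).

Lemma conv_prod (F : comPzRingType) (f g : forall i, R i -> F) (c : prod_ring R) :
  conv (fun x : prod_ring R => \prod_i f i (x i)) (fun x => \prod_i g i (x i)) c =
  \prod_i conv (f i) (g i) (c i).
Proof.
rewrite -(sum_prod_dffun (fun i z => f i z * g i (c i - z))).
apply: eq_bigr => z _; rewrite -big_split; apply: eq_bigr => i _ /=.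
by rewrite !ffunE.
Qed.

Lemma units_prod (x : prod_ring R) : (x \in units (prod_ring R)) = [forall i, x i \in units (R i)].
Proof.
apply/unitsP/forallP => [[v vx] i|xU].
  by apply/unitsP; exists (v i); have := congr1 (fun y : prod_ring R => y i) vx; rewrite !ffunE.
have inv i : exists v, v * x i == 1 by case/unitsP: (xU i) => v /eqP; exists v.
exists [ffun i => xchoose (inv i)]; apply/ffunP => i; rewrite !ffunE.
exact/eqP/(xchooseP (inv i)).
Qed.

Lemma unit_squares_prod (x : prod_ring R) :
  (x \in unit_squares (prod_ring R)) = [forall i, x i \in unit_squares (R i)].
Proof.
apply/imsetP/forallP => [[u] |xS].
  rewrite units_prod => /forallP uU -> i.
  by apply/imsetP; exists (u i); [exact: uU | rewrite !expr2 ffunE].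
have sq i : exists u, (u \in units (R i)) && (x i == u ^+ 2).
  by case/imsetP: (xS i) => u uU /eqP; exists u; rewrite uU.
exists [ffun i => xchoose (sq i)].
  by rewrite units_prod; apply/forallP => i; rewrite ffunE; case/andP: (xchooseP (sq i)).
by apply/ffunP => i; rewrite expr2 !ffunE -expr2; case/andP: (xchooseP (sq i)) => _ /eqP.
Qed.

Lemma natr_forall (F : comPzSemiRingType) (b : pred I) :
  ([forall i, b i])%:R = \prod_i (b i)%:R :> F.
Proof.
have [/forallP b1|] := boolP [forall i, b i]; first by rewrite big1 // => i _; rewrite b1.
rewrite negb_forall => /existsP[i /negbTE bi].
by rewrite (bigD1 i) //= bi mul0r.
Qed.

Lemma card_units_prod (F : comPzRingType) :
  #|units (prod_ring R)|%:R = \prod_i #|units (R i)|%:R :> F.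
Proof.
have cardE (T : finType) (A : {set T}) : #|A|%:R = \sum_x (x \in A)%:R :> F.
  by rewrite -natr_sum -big_mkcond sum1_card.
rewrite cardE (eq_bigr (fun x : prod_ring R => \prod_i (x i \in units (R i))%:R)).
  by rewrite (sum_prod_dffun (fun i y => (y \in units (R i))%:R)); apply: eq_bigr.
by move=> x _; rewrite units_prod natr_forall.
Qed.

Lemma pm_unit_squares_prod (x : prod_ring R) :
    (forall i, -1 \in unit_squares (R i)) ->
  (x \in pm_unit_squares (prod_ring R)) = [forall i, x i \in unit_squares (R i)].
Proof.
move=> S1; rewrite inE -unit_squares_prod orb_idr // => /imsetP[_ /imsetP[u uU ->] ->].
have /imsetP[v vU v2] : (- 1 : prod_ring R) \in unit_squares (prod_ring R).
  by rewrite unit_squares_prod; apply/forallP => i; rewrite !ffunE; apply: S1.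
apply/imsetP; exists (v * u); last by rewrite exprMn -v2 mulN1r.
move: uU vU; rewrite !units_prod => /forallP uU /forallP vU.
apply/forallP => i; rewrite ffunE; case/unitsP: (uU i) => a au; case/unitsP: (vU i) => b bv.
by apply/unitsP; exists (b * a); rewrite mulrACA au bv mulr1.
Qed.

End ProductRing.

Definition disjoint_pair (I : finType) (f : {ffun I -> option bool}) : {set I} * {set I} :=
  ([set i | f i == Some true], [set i | f i == Some false]).

Lemma big_disjoint_pairs (V : Type) (idx : V) (op : Monoid.com_law idx) (I : finType)
    (G : {set I} * {set I} -> V) :
  \big[op/idx]_(AB : {set I} * {set I} | [disjoint AB.1 & AB.2]) G AB =
  \big[op/idx]_(f : {ffun I -> option bool}) G (disjoint_pair f).
Proof.
pose fn (AB : {set I} * {set I}) : {ffun I -> option bool} :=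
  [ffun i => if i \in AB.1 then Some true else if i \in AB.2 then Some false else None].
rewrite (reindex_onto (@disjoint_pair I) fn) /=.
  apply: eq_bigl => f; apply/andP; split.
    rewrite -setI_eq0; apply/eqP/setP => i; rewrite !inE.
    by case: (f i) => [[]|].
  by apply/eqP/ffunP => i; rewrite !ffunE !inE; case: (f i) => [[]|].
move=> [A B] /= AB; congr pair; apply/setP => i; rewrite !inE ffunE /=.
  by case: ifP => // _; case: ifP.
case: ifP => [iA|_]; last by case: ifP.
by rewrite (disjointFr AB iA).
Qed.

Section Product.
Variables (F : rcfType) (s : nat) (R : 'I_s -> finComNzRingType).
Variable M : forall i : 'I_s, {set R i}.
Hypothesis localM : forall i, local_with_maximal_ideal (M i).
Hypothesis q_mod4 : forall i : 'I_s, residue_card M i = 1 %[mod 4].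

Implicit Types f : {ffun 'I_s -> option bool}.

Definition prod_idem f (x : prod_ring R) : F := \prod_i local_idem F (M i) (f i) (x i).

Lemma lambda_mult_disjoint_pair f :
  lambda_mult M (disjoint_pair f).1 (disjoint_pair f).2 =
  (\prod_i local_mult (residue_card M i) (f i))%N.
Proof.
set A := _.1; set B := _.2.
have AB0 : [disjoint A & B].
  rewrite -setI_eq0; apply/eqP/setP => i; rewrite !inE.
  by case: (f i) => [[]|].
have in_AB i : (i \in A :|: B) = (f i != None) by rewrite !inE; case: (f i) => [[]|].
rewrite /lambda_mult; have -> : (#|A| + #|B| = #|A :|: B|)%N.
  by apply/esym/eqP; rewrite (leq_card_setU A B).2.
have -> : (\prod_i local_mult (residue_card M i) (f i) =
    \prod_(i in A :|: B) ((residue_card M i - 1) %/ 2))%N.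
  rewrite [RHS]big_mkcond; apply: eq_bigr => i _; rewrite in_AB.
  by case: (f i).
have -> : (\prod_(k in A :|: B) (residue_card M k - 1) =
  (\prod_(i in A :|: B) ((residue_card M i - 1) %/ 2)) * 2 ^ #|A :|: B|)%N.
  rewrite -prod_nat_const -big_split; apply: eq_bigr => i _ /=.
  by have := q_mod4 i; move: (residue_card M i) => k; lia.
by rewrite mulnK // expn_gt0.
Qed.

Lemma lambda_disjoint_pair f :
  lambda M F (disjoint_pair f).1 (disjoint_pair f).2 =
  \prod_i local_eigenvalue F #|units (R i)| (residue_card M i) (f i).
Proof.
rewrite /lambda card_units_prod -prodr_const.
have -> : 2 ^+ s = \prod_(i < s) 2 :> F by rewrite prodr_const card_ord.
rewrite !(big_mkcond (fun i => i \in _)) /= -!big_split /= -prodfV -!big_split /=.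
apply: eq_bigr => i _; rewrite !inE /local_eigenvalue !invfM.
by case: (f i) => [[]|] /=; rewrite ?invr1 ?mulr1 ?mul1r ?mulrA ?mulN1r ?mulrN ?mulNr.
Qed.

Lemma zero_mult_disjoint_pair :
  zero_mult M =
  (#|prod_ring R| - \sum_(f : {ffun 'I_s -> option bool}) \prod_i local_mult (residue_card M i) (f i))%N.
Proof.
rewrite /zero_mult (pair_big_dep xpredT (fun A B : {set 'I_s} => [disjoint A & B])) /=.
rewrite (big_disjoint_pairs _ (fun AB => lambda_mult M AB.1 AB.2)).
by congr subn; apply: eq_bigr => f _; rewrite lambda_mult_disjoint_pair.
Qed.

Lemma adjacency_mx_prod :
  adjacency_mx F (@quad_unitary_adj (prod_ring R)) =
  \sum_(f : {ffun 'I_s -> option bool}) (\prod_i local_eigenvalue F #|units (R i)| (residue_card M i) (f i)) *: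
     conv_mx (prod_idem f).
Proof.
apply/matrixP => k l; rewrite summxE !mxE /quad_unitary_adj.
rewrite pm_unit_squares_prod => [|i]; last exact: opp1_unit_square (localM i) (q_mod4 i).
set x := _ - _; rewrite natr_forall.
under eq_bigr => i _ do rewrite (unit_squares_local_idem F (localM i)).
rewrite bigA_distr_bigA; apply: eq_bigr => f _.
by rewrite !mxE -big_split.
Qed.

Lemma conv_mx_prod_idem f g :
  conv_mx (prod_idem f) *m conv_mx (prod_idem g) =
  if f == g then conv_mx (prod_idem f) else 0.
Proof.
have convE x : conv (prod_idem f) (prod_idem g) x =
    \prod_i (if f i == g i then local_idem F (M i) (f i) (x i) else 0).
  rewrite /prod_idem (conv_prod (fun i => local_idem F (M i) (f i))
    (fun i => local_idem F (M i) (g i))).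
  by apply: eq_bigr => i _; rewrite (conv_local_idem _ (localM i) (q_mod4 i)).
rewrite conv_mx_mul; have [fg|fg] := eqVneq f g.
  apply: eq_conv_mx => x; rewrite convE.
  by apply: eq_bigr => i _; rewrite -fg eqxx.
have [i fgi] : exists i, f i != g i.
  apply/existsP; apply: contraNT fg; rewrite negb_exists => /forallP fg.
  by apply/eqP/ffunP => i; apply/eqP; rewrite -[_ == _]negbK fg.
apply/matrixP => k l; rewrite !mxE convE (bigD1 i) //= (negbTE fgi).
by rewrite mul0r.
Qed.

Lemma conv_mx_prod_idem_trace f :
  \tr (conv_mx (prod_idem f)) =
  (\prod_i local_mult (residue_card M i) (f i))%:R.
Proof.
have cardE (T : finType) : #|T|%:R = \sum_(x : T) 1 :> F.
  by rewrite sumr_const.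
rewrite conv_mx_trace natr_prod cardE.
rewrite (eq_bigr (fun x : prod_ring R => \prod_(i < s) 1)) => [|x _]; last by rewrite big1_eq.
rewrite (sum_prod_dffun (fun i (y : R i) => 1 : F)) -big_split /=.
apply: eq_bigr => i _; rewrite -cardE ffunE.
exact: trace_local_idem (localM i) (q_mod4 i) _.
Qed.

End Product.

Theorem theorem2p6 (F : rcfType) (s : nat) (R : 'I_s -> finComNzRingType)
    (M : forall i : 'I_s, {set R i})
    (R_nontrivial : (1 : prod_ring R) != 0)
    (R_local : forall i : 'I_s, local_with_maximal_ideal (M i))
    (residue_le : forall i j : 'I_s,
       (i <= j)%N -> (residue_card M i <= residue_card M j)%N)
    (residue_mod4 : forall i : 'I_s, residue_card M i = 1 %[mod 4]) :
  eigenvalues_are (adjacency_mx F (@quad_unitary_adj (prod_ring R)))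
    (flatten [seq nseq (lambda_mult M AB.1 AB.2) (lambda M F AB.1 AB.2)
             | AB : {set 'I_s} * {set 'I_s} in
                 [pred AB : {set 'I_s} * {set 'I_s} | [disjoint AB.1 & AB.2]]]
     ++ nseq (zero_mult M) 0).
Proof.
have R_gt0 : (0 < #|prod_ring R|)%N by apply/card_gt0P; exists 0.
rewrite /eigenvalues_are (adjacency_mx_prod F R_local residue_mod4).
have [_ ->] := char_poly_sum_idempotents
  (fun f : {ffun 'I_s -> option bool} => \prod_i local_eigenvalue F #|units (R i)| (residue_card M i) (f i))
  R_gt0 (conv_mx_prod_idem F R_local residue_mod4)
  (conv_mx_prod_idem_trace F R_local residue_mod4).
rewrite big_cat big_flatten big_image /= big_nseq iter_mulr_1 subr0.
rewrite zero_mult_disjoint_pair // mulrC; congr (_ * _).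
rewrite (eq_bigl (fun AB : {set 'I_s} * {set 'I_s} => [disjoint AB.1 & AB.2])) //.
rewrite big_disjoint_pairs.
apply: eq_bigr => f _.
by rewrite big_nseq iter_mulr_1 lambda_mult_disjoint_pair ?lambda_disjoint_pair.
Qed.
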